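(* Let $q$ be an odd prime power. Then there exists a smooth symmetric space filling curve $C_{f,f}$ over $\mathbb{F}_q$; that is, there exists a homogeneous polynomial $f$ in two variables of degree $q+1$ with coefficients in $\mathbb{F}_q$ such that $C_{f,f} \subset (\mathbb{P}^1\times\mathbb{P}^1)_{\mathbb{F}_q}$ is a smooth space filling curve.
   Context: $\mathbb{F}_q$ is the finite field with $q$ elements and $\overline{\mathbb{F}}_q$ its algebraic closure. $\mathbb{F}_q[Z_0,Z_1]_d$ denotes the $\mathbb{F}_q$-space of homogeneous polynomials of degree $d$. $V(\cdot)$ denotes the zero locus of a bihomogeneous polynomial. For $f \in \mathbb{F}_q[Y_0,Y_1]_{q+1}$ and $g\in\mathbb{F}_q[X_0,X_1]_{q+1}$, let $$F = f(Y_0,Y_1)(X_0^qX_1 - X_0X_1^q) + g(X_0,X_1)(Y_0^qY_1 - Y_0Y_1^q),$$ which is bihomogeneous of bidegree $(q+1,q+1)$ in $(X_0,X_1;Y_0,Y_1)$, and let $C_{f,g} = V(F) \subset (\mathbb{P}^1\times\mathbb{P}^1)_{\mathbb{F}_q}$, where $X_0,X_1$ (resp. $Y_0,Y_1$) are the homogeneous coordinates on the first (resp. second) factor. The curve $C_{f,g}$ is called symmetric if $g(X_0,X_1)=f(X_0,X_1)$, in which case it is written $C_{f,f}$; so $C_{f,f}$ is defined by $f(Y_0,Y_1)(X_0^qX_1 - X_0X_1^q) + f(X_0,X_1)(Y_0^qY_1 - Y_0Y_1^q)$. A subscheme $C\subset \mathbb{P}^1\times\mathbb{P}^1$ over $\mathbb{F}_q$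 is a space filling curve if $\dim C = 1$ and $C(\mathbb{F}_q) = (\mathbb{P}^1\times\mathbb{P}^1)(\mathbb{F}_q)$. The curve $C=V(F)$ is smooth if and only if there is no point $P\in C(\overline{\mathbb{F}}_q)$ with $F(P)=F_{X_0}(P)=F_{X_1}(P)=F_{Y_0}(P)=F_{Y_1}(P)=0$, where subscripts denote formal partial derivatives. *)

(* Defs.v *)
From HB Require Import structures.
From mathcomp Require Import all_boot all_order all_algebra all_field.
From mathcomp Require Import classical_sets.
From mathcomp Require Import mpoly.

Set Implicit Arguments.
Unset Strict Implicit.
Unset Printing Implicit Defensive.

Import GRing.Theory.
Local Open Scope classical_set_scope.
Local Open Scope ring_scope.

(* The variables X_0, X_1, Y_0, Y_1 of {mpoly F[4]}, in this order. *)
Definition iX0 : 'I_4 := @Ordinal 4 0 isT.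
Definition iX1 : 'I_4 := @Ordinal 4 1 isT.
Definition iY0 : 'I_4 := @Ordinal 4 2 isT.
Definition iY1 : 'I_4 := @Ordinal 4 3 isT.

Section Curves.
Variable F : finFieldType.

Definition curve_poly (q : nat) (f g : {mpoly F[2]}) : {mpoly F[4]} :=
    (f \mPo [tuple 'X_iY0; 'X_iY1]) * ('X_iX0 ^+ q * 'X_iX1 - 'X_iX0 * 'X_iX1 ^+ q)
  + (g \mPo [tuple 'X_iX0; 'X_iX1]) * ('X_iY0 ^+ q * 'X_iY1 - 'X_iY0 * 'X_iY1 ^+ q).

Definition bihomogeneous (d e : nat) (P : {mpoly F[4]}) : Prop :=
  {in msupp P, forall m : 'X_{1..4}, (m iX0 + m iX1 = d)%N /\ (m iY0 + m iY1 = e)%N}.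

(* A K-point of P^1 x P^1 is given by its homogeneous coordinates. Subsets of
   P^1 x P^1 are represented by the set of all coordinate vectors of their
   points, so that inclusion and equality of subsets are those of sets of
   coordinate vectors. *)
Definition P1xP1 (K : fieldType) : set ('I_4 -> K) :=
  [set v | ((v iX0 != 0) || (v iX1 != 0)) && ((v iY0 != 0) || (v iY1 != 0))].

Section Points.
Variables (K : fieldType) (iota : {rmorphism F -> K}).

Definition evalK (P : {mpoly F[4]}) (v : 'I_4 -> K) : K :=
  (map_mpoly iota P).@[v].

Definition zero_locus (P : {mpoly F[4]}) : set ('I_4 -> K) :=
  [set v | P1xP1 v /\ evalK P v = 0].

(* When K is an algebraic closure of F, the closed subsets of the F-scheme
   P^1 x P^1 correspond, with their inclusions, to the zero loci in
   (P^1 x P^1)(K) of sets of bihomogeneous polynomials with coefficients in F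
   (a closed point of the scheme being a conjugacy class of K-points). *)
Definition zariski_closed (Z : set ('I_4 -> K)) : Prop :=
  exists S : set {mpoly F[4]},
    (forall P, S P -> exists d e, bihomogeneous d e P) /\
    Z = [set v | P1xP1 v /\ forall P, S P -> evalK P v = 0].

Definition irreducible_closed (Z : set ('I_4 -> K)) : Prop :=
  [/\ zariski_closed Z, Z !=set0
    & forall A B, zariski_closed A -> zariski_closed B ->
        Z `<=` A `|` B -> Z `<=` A \/ Z `<=` B].

Definition has_chain (C : set ('I_4 -> K)) (n : nat) : Prop :=
  exists Z : nat -> set ('I_4 -> K),
    (forall i, (i <= n)%N -> irreducible_closed (Z i) /\ Z i `<=` C) /\
    (forall i, (i < n)%N -> Z i `<` Z i.+1).

Definition has_krull_dim (C : set ('I_4 -> K)) (n : nat) : Prop :=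
  has_chain C n /\ forall m, has_chain C m -> (m <= n)%N.

Definition smooth_curve (P : {mpoly F[4]}) : Prop :=
  ~ exists v, zero_locus P v /\ forall i : 'I_4, evalK (P^`M(i)) v = 0.

End Points.

Definition space_filling_curve (K : fieldType) (iota : {rmorphism F -> K})
    (P : {mpoly F[4]}) : Prop :=
  has_krull_dim iota (zero_locus iota P) 1 /\
  zero_locus (idfun : {rmorphism F -> F}) P = @P1xP1 F.

End Curves.

(* Main.v *)
Require Import Defs.
From HB Require Import structures.
From mathcomp Require Import all_boot all_order all_algebra all_field.
From mathcomp Require Import boolp classical_sets.
From mathcomp Require Import mpoly.
From mathcomp Require Import ring.

(** Let A(X) = X0^q X1 - X0 X1^q (fermat_form), whose only zeros on P^1 are the
    rational points, and let n be a nonsquare of F. The curve attached to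
      f = X0^(q+1) - n X1^(q+1) + A(X)
    (special_form) works.

    Space filling is immediate, since A vanishes at all rational points.

    Smoothness: put h = f / A, a rational function of degree q+1 on P^1. As f
    has no rational zero, a singular point of f(Y) A(X) + f(X) A(Y) is a pair
    of critical points x, y of h with h(x) = - h(y) (lemma critical_point).
    The critical points of h are the two square roots of n, on which
    Frobenius acts as -1, so that h(x) = x + 1 there (lemma
    special_val_critical). A singular point would thus give x^2 = y^2 = n
    with x + y = - 2, whence y = - 1 in odd characteristic and n = 1, which is
    a square. The summand A(X) of f is there to move the critical values,
    which without it would be opposite to each other.

    Dimension: a bihomogeneous polynomial is studied through its restriction
    to the affine chart X1 = Y1 = 1, an element of F[x][y], where coprimality
    in F(x)[y] gives a Bezout relation with a nonzero right-hand side in F[x].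
    - A chain of length one (has_chain1) comes from a factor p of the affine
      equation that is irreducible over F(x): the locus of all polynomials
      divisible by p over F(x) is irreducible, and it strictly contains the
      class of conjugates of any of its points.
    - There is no chain Z0 < Z1 < Z2 in the curve (chain_le1). An equation of
      Z1 that does not hold on Z2 is eliminated with the equation of the
      curve, leaving a nonzero polynomial in x that vanishes on Z1
      (prime_ideal_elimination), so Z1 has finitely many points. All of them
      are defined over the field with q^k elements for some k, and the identity
      c^(q^k) = c makes each polynomial on Z1 zero or invertible; hence an
      irreducible Z1 has no proper closed nonempty subset
      (coords_fixed_minimal). *)

Set Implicit Arguments.
Unset Strict Implicit.
Unset Printing Implicit Defensive.

Import GRing.Theory.
Local Open Scope ring_scope.

(** * Bihomogeneous polynomials and their values *)

Definition degX (m : 'X_{1..4}) : nat := (m iX0 + m iX1)%N.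
Definition degY (m : 'X_{1..4}) : nat := (m iY0 + m iY1)%N.

Fact degX0 : degX 0%MM = 0%N. Proof. by rewrite /degX !mnm0E. Qed.
Fact degXD : {morph degX : m1 m2 / (m1 + m2)%MM >-> (m1 + m2)%N}.
Proof. by move=> a b; rewrite /degX !mnmDE addnACA. Qed.
Fact degY0 : degY 0%MM = 0%N. Proof. by rewrite /degY !mnm0E. Qed.
Fact degYD : {morph degY : m1 m2 / (m1 + m2)%MM >-> (m1 + m2)%N}.
Proof. by move=> a b; rewrite /degY !mnmDE addnACA. Qed.
HB.instance Definition _ := isMeasure.Build 4 degX degX0 degXD.
HB.instance Definition _ := isMeasure.Build 4 degY degY0 degYD.

Section Bihomogeneous.
Variable F : finFieldType.
Implicit Types P Q : {mpoly F[4]}.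

Lemma bihomP d e P : bihomogeneous d e P <->
  P \is d.-homog for degX /\ P \is e.-homog for degY.
Proof.
split=> [h|[/dhomogP hx /dhomogP hy] m hm]; last by split; [apply: hx|apply: hy].
by split; apply/dhomogP => m /h [].
Qed.

Lemma bihomM d e d' e' P Q : bihomogeneous d e P -> bihomogeneous d' e' Q ->
  bihomogeneous (d + d') (e + e') (P * Q).
Proof. by move=> /bihomP[? ?] /bihomP[? ?]; apply/bihomP; split; apply: dhomogM. Qed.

Lemma bihomX d e P k : bihomogeneous d e P ->
  bihomogeneous (d * k) (e * k) (P ^+ k).
Proof. by move=> /bihomP[? ?]; apply/bihomP; split; apply: dhomogMn. Qed.

Lemma bihomD d e P Q : bihomogeneous d e P -> bihomogeneous d e Q ->
  bihomogeneous d e (P + Q).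
Proof. by move=> /bihomP[? ?] /bihomP[? ?]; apply/bihomP; split; apply: dhomogD. Qed.

Lemma bihomN d e P : bihomogeneous d e P -> bihomogeneous d e (- P).
Proof. by move=> /bihomP[? ?]; apply/bihomP; rewrite !dhomogN. Qed.

Lemma bihomZ d e c P : bihomogeneous d e P -> bihomogeneous d e (c *: P).
Proof. by move=> /bihomP[? ?]; apply/bihomP; split; apply: dhomogZ. Qed.

Lemma bihom_sum d e (I : Type) (r : seq I) (p : pred I) (f : I -> {mpoly F[4]}) :
  (forall i, p i -> bihomogeneous d e (f i)) ->
  bihomogeneous d e (\sum_(i <- r | p i) f i).
Proof.
move=> h; elim/big_ind: _ => //; last by move=> *; apply: bihomD.
by move=> m; rewrite msupp0.
Qed.

Lemma bihom_varX (i : 'I_4) : (i < 2)%N ->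
  bihomogeneous 1 0 ('X_i : {mpoly F[4]}).
Proof.
move=> i2; apply/bihomP; rewrite !dhomogX /= /degX /degY !mnm1E -!val_eqE /=.
by case: i i2 => [[|[]]].
Qed.

Lemma bihom_varY (i : 'I_4) : (1 < i)%N ->
  bihomogeneous 0 1 ('X_i : {mpoly F[4]}).
Proof.
move=> i2; apply/bihomP; rewrite !dhomogX /= /degX /degY !mnm1E -!val_eqE /=.
by case: i i2 => [[|[|[|[|]]]]].
Qed.

End Bihomogeneous.

Arguments bihomM {F d e d' e' P Q} _ _.
Arguments bihomX {F d e P} k _.
Arguments bihomD {F d e P Q} _ _.
Arguments bihomN {F d e P} _.
Arguments bihomZ {F d e} c {P} _.
Arguments bihom_varX {F} i _.
Arguments bihom_varY {F} i _.

Lemma ord4E (i : 'I_4) : [|| i == iX0, i == iX1, i == iY0 | i == iY1].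
Proof. by case: i => [[|[|[|[|]]]]]. Qed.

Lemma prod4E (R : comNzRingType) (G : 'I_4 -> R) :
  \prod_(i < 4) G i = G iX0 * G iX1 * G iY0 * G iY1.
Proof.
rewrite !big_ord_recl big_ord0 mulr1 !mulrA.
have e (i j : 'I_4) : val i = val j -> G i = G j by move/val_inj->.
by congr (_ * _ * _ * _); apply: e.
Qed.

Section Evaluation.
Variables (F : finFieldType) (K : fieldType) (iota : {rmorphism F -> K}).
Implicit Types (P Q : {mpoly F[4]}) (v : 'I_4 -> K).

Local Notation ev := (evalK iota).

Lemma evM P Q v : ev (P * Q) v = ev P v * ev Q v.
Proof. by rewrite /evalK !rmorphM. Qed.
Lemma evD P Q v : ev (P + Q) v = ev P v + ev Q v.
Proof. by rewrite /evalK !rmorphD. Qed.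
Lemma evN P v : ev (- P) v = - ev P v.
Proof. by rewrite /evalK !rmorphN. Qed.
Lemma evX P n v : ev (P ^+ n) v = ev P v ^+ n.
Proof. by rewrite /evalK !rmorphXn. Qed.
Lemma evZ c P v : ev (c *: P) v = iota c * ev P v.
Proof. by rewrite /evalK map_mpolyZ mevalZ. Qed.
Lemma ev_var i v : ev 'X_i v = v i.
Proof. by rewrite /evalK map_mpolyX mevalXU. Qed.
Lemma evC c v : ev c%:MP v = iota c.
Proof. by rewrite /evalK map_mpolyC mevalC. Qed.
Lemma ev_sum (I : Type) (r : seq I) (p : pred I) (f : I -> {mpoly F[4]}) v :
  ev (\sum_(i <- r | p i) f i) v = \sum_(i <- r | p i) ev (f i) v.
Proof. by apply: (big_morph (fun P => ev P v)) => [P Q|]; rewrite ?evD // /evalK !rmorph0. Qed.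

(** Every statement below on how values change under rescaling, Frobenius or
    restriction to a chart is read off this expansion. *)
Lemma evE P v : ev P v = \sum_(m <- msupp P) iota P@_m *
  (v iX0 ^+ m iX0 * v iX1 ^+ m iX1 * v iY0 ^+ m iY0 * v iY1 ^+ m iY1).
Proof.
rewrite {1}[P]mpolyE ev_sum; apply: eq_bigr => m _.
by rewrite evZ /evalK map_mpolyX mevalX prod4E.
Qed.

(** All choices of homogeneous coordinates of the point v, when a and b are
    nonzero. *)
Definition rescale a b v : 'I_4 -> K :=
  fun i => if (i < 2)%N then a * v i else b * v i.

Lemma ev_rescale d e P a b v : bihomogeneous d e P ->
  ev P (rescale a b v) = a ^+ d * b ^+ e * ev P v.
Proof.
move=> hP; rewrite !evE mulr_sumr; apply: eq_big_seq => m /hP [<- <-].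
by rewrite /rescale /= !exprMn !exprD; ring.
Qed.

(** {poly {poly F}} is F[x][y]: the inner variable is x = X0 / X1 and the outer
    one is y = Y0 / Y1. *)
Definition ev1 (x : K) : {poly F} -> K := horner_eval x \o map_poly iota.
HB.instance Definition _ x :=
  GRing.RMorphism.copy (ev1 x) (horner_eval x \o map_poly iota).
Definition ev2 (x y : K) : {poly {poly F}} -> K :=
  horner_eval y \o map_poly (ev1 x).
HB.instance Definition _ x y :=
  GRing.RMorphism.copy (ev2 x y) (horner_eval y \o map_poly (ev1 x)).

Lemma ev1X x : ev1 x 'X = x.
Proof. by rewrite /ev1 /= map_polyX /horner_eval hornerX. Qed.
Lemma ev1C x c : ev1 x c%:P = iota c.
Proof. by rewrite /ev1 /= map_polyC /horner_eval hornerC. Qed.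
Lemma ev2X x y : ev2 x y 'X = y.
Proof. by rewrite /ev2 /= map_polyX /horner_eval hornerX. Qed.
Lemma ev2C x y c : ev2 x y c%:P = ev1 x c.
Proof. by rewrite /ev2 /= map_polyC /horner_eval hornerC. Qed.

Lemma ev2E x y p : ev2 x y p =
  \sum_(j < size p) \sum_(i < size p`_j) iota p`_j`_i * (x ^+ i * y ^+ j).
Proof.
rewrite -{1}[p]coefK poly_def rmorph_sum; apply: eq_bigr => j _.
rewrite -mul_polyC rmorphM rmorphXn /= ev2C ev2X -{1}[p`_j]coefK poly_def.
rewrite rmorph_sum mulr_suml; apply: eq_bigr => i _.
by rewrite -mul_polyC rmorphM rmorphXn /= ev1C ev1X mulrA.
Qed.

(** Restriction to the chart X1 = Y1 = 1. *)
Definition dehom : {mpoly F[4]} -> {poly {poly F}} :=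
  mmap (polyC \o polyC) (fun i => nth 1 [:: 'X%:P; 1; 'X; 1] i).
Lemma ev2_dehom P v x y : v iX0 = x -> v iX1 = 1 -> v iY0 = y -> v iY1 = 1 ->
  ev2 x y (dehom P) = ev P v.
Proof.
move=> h0 h1 h2 h3; rewrite evE h0 h1 h2 h3 /dehom /mmap rmorph_sum /=.
apply: eq_bigr => m _; rewrite rmorphM /= ev2C ev1C /mmap1 prod4E /=.
by rewrite !rmorphM !rmorphXn !rmorph1 /= ev2C ev1X ev2X.
Qed.

Lemma ev_dehom d e P v : bihomogeneous d e P -> v iX1 != 0 -> v iY1 != 0 ->
  ev P v = v iX1 ^+ d * v iY1 ^+ e *
           ev2 (v iX0 / v iX1) (v iY0 / v iY1) (dehom P).
Proof.
move=> hP h1 h3.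
rewrite (@ev2_dehom P (rescale (v iX1)^-1 (v iY1)^-1 v)) /rescale /= ?mulVf 1?mulrC //.
rewrite (ev_rescale _ _ _ hP) mulrC mulrA mulrACA -!exprMn.
by rewrite !mulfV // !expr1n !mul1r.
Qed.

(** The exponent N exceeds both partial degrees, so each monomial of P contains
    X1 and Y1. Thus P vanishes on the boundary of the chart, and as 0^-1 = 0 and
    0 < N the formula for its values needs no case distinction. *)
Lemma homogenize (p : {poly {poly F}}) : exists N (P : {mpoly F[4]}),
  [/\ (0 < N)%N, bihomogeneous N N P & forall v, ev P v =
    (v iX1 * v iY1) ^+ N * ev2 (v iX0 / v iX1) (v iY0 / v iY1) p].
Proof.
pose n := (maxn (size p) (\max_(j < size p) size (p`_j)%R)).+1.
pose M i j : {mpoly F[4]} :=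
  'X_iX0 ^+ i * 'X_iX1 ^+ (n - i) * ('X_iY0 ^+ j * 'X_iY1 ^+ (n - j)).
have hn (j : 'I_(size p)) (i : 'I_(size p`_j)) : (i < n)%N /\ (j < n)%N.
  split; last by rewrite ltnS ltnW // (leq_trans (ltn_ord j)) // leq_maxl.
  rewrite ltnS ltnW // (leq_trans (ltn_ord i)) // (leq_trans _ (leq_maxr _ _)) //.
  exact: (leq_bigmax (F := fun j : 'I_(size p) => size (p`_j)%R)).
exists n, (\sum_(j < size p) \sum_(i < size p`_j) p`_j`_i *: M i j); split=> [||v] //.
  apply: bihom_sum => j _; apply: bihom_sum => i _; apply: bihomZ.
  have [hi hj] := hn j i.
  have := bihomM (bihomM (bihomX i (bihom_varX iX0 isT))
                         (bihomX (n - i) (bihom_varX iX1 isT)))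
                 (bihomM (bihomX j (bihom_varY iY0 isT))
                         (bihomX (n - j) (bihom_varY iY1 isT))).
  by rewrite !mul1n !mul0n !addn0 !add0n !subnKC // ltnW.
rewrite ev_sum ev2E mulr_sumr; apply: eq_bigr => j _.
rewrite ev_sum mulr_sumr; apply: eq_bigr => i _; have [hi hj] := hn j i.
rewrite evZ !evM !evX !ev_var exprMn !expr_div_n.
have powE (a b : K) k : (k < n)%N -> b ^+ n * (a ^+ k / b ^+ k) = a ^+ k * b ^+ (n - k).
  move=> hk; have [->|b0] := eqVneq b 0.
    by rewrite !expr0n subn_eq0 leqNgt hk /= mul0r mulr0.
  by rewrite -[in LHS](subnKC (ltnW hk)) exprD mulrCA [b ^+ k * _]mulrC mulfK ?expf_neq0.
by rewrite -!powE //; ring.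
Qed.
End Evaluation.

(** * The Frobenius map of the ground field *)

Section Frobenius.
Variables (F : finFieldType) (q : nat) (hF : #|F| = q).
Variables (K : fieldType) (iota : {rmorphism F -> K}).

Lemma q_gt1 : (1 < q)%N.
Proof. by rewrite -hF finNzRing_gt1. Qed.

Lemma q_gt0 : (0 < q)%N.
Proof. exact: ltnW q_gt1. Qed.

(** The ring R is arbitrary so as to cover both the overfields of F and the
    polynomial rings over F. *)
Lemma q_eq0 (R : nzRingType) (j : {rmorphism F -> R}) : q%:R = 0 :> R.
Proof.
have [p pr_p chF] := finPcharP F.
have [n oF] : exists n, #|F| = (p ^ n)%N by eexists; exact: card_pprimeChar chF.
rewrite -hF oF -(rmorph_nat j) natrX (pcharf0 chF) expr0n.
by case: n oF => [oF|n _]; rewrite ?rmorph0 //; have := finNzRing_gt1 F; rewrite oF.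
Qed.

Lemma frobD (a b : K) : (a + b) ^+ q = a ^+ q + b ^+ q.
Proof.
have [p pr_p chF] := finPcharP F; apply: exprDn_pchar.
rewrite -hF (card_pprimeChar chF) pnatX; apply/orP; left.
by rewrite pnatE // (fmorph_pchar iota).
Qed.

Lemma frob0 : 0 ^+ q = 0 :> K.
Proof. by rewrite expr0n gtn_eqF ?q_gt0. Qed.

Lemma frobN (a : K) : (- a) ^+ q = - a ^+ q.
Proof.
by apply/eqP; rewrite -addr_eq0 -frobD addNr frob0.
Qed.

Lemma frobB (a b : K) : (a - b) ^+ q = a ^+ q - b ^+ q.
Proof. by rewrite frobD frobN. Qed.

Lemma frob_inj : injective (fun a : K => a ^+ q).
Proof.
move=> a b /= /eqP; rewrite -subr_eq0 -frobB expf_eq0 subr_eq0.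
by case/andP=> _ /eqP.
Qed.

Lemma frob_iota c : iota c ^+ q = iota c.
Proof. by rewrite -rmorphXn /= -hF expf_card. Qed.

(** The polynomial X^q - X splits over F with the elements of F as its roots. *)
Lemma frob_fixed (a : K) : a ^+ q = a -> exists c, a = iota c.
Proof.
move=> ha; have := congr1 (map_poly iota) (finField_genPoly F).
rewrite rmorphB /= map_polyXn map_polyX rmorph_prod hF => /(congr1 (horner^~ a)).
rewrite !hornerE ha subrr => /esym/eqP; rewrite horner_prod prodf_seq_eq0.
case/hasP => c _; rewrite /= rmorphB /= map_polyX map_polyC !hornerE subr_eq0.
by move/eqP->; exists c.
Qed.

Lemma frob_iter_fixed (a : K) k : a ^+ q = a -> a ^+ (q ^ k) = a.
Proof. by move=> ha; elim: k => // k ih; rewrite expnS exprM ha. Qed.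

Lemma frob_iter_inj k : injective (fun a : K => a ^+ (q ^ k)).
Proof.
elim: k => [|k ih] a b //=; rewrite expnS !exprM => h.
by apply: frob_inj; apply: ih.
Qed.

Lemma ev_frob (P : {mpoly F[4]}) (v : 'I_4 -> K) :
  evalK iota P v ^+ q = evalK iota P (fun i => v i ^+ q).
Proof.
rewrite !evE (big_morph (fun a : K => a ^+ q) frobD frob0).
by apply: eq_bigr => m _; rewrite !exprMn frob_iota -!exprM ![(q * _)%N]mulnC.
Qed.

Lemma ev_frob_iter k (P : {mpoly F[4]}) (v : 'I_4 -> K) :
  evalK iota P v ^+ (q ^ k) = evalK iota P (fun i => v i ^+ (q ^ k)).
Proof.
elim: k => [|k ih]; first by rewrite expr1; congr evalK.
rewrite expnSr exprM ih ev_frob; congr evalK.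
by apply/funext => i; rewrite -exprM.
Qed.

Lemma root_frob (m : {poly F}) (x : K) k :
  root (map_poly iota m) x -> root (map_poly iota m) (x ^+ (q ^ k)).
Proof.
elim: k => // k ih /ih {ih} h; rewrite expnSr exprM.
move: (x ^+ _) h => {x} x /rootP h; apply/rootP.
have : (map_poly iota m).[x] ^+ q = 0 by rewrite h frob0.
rewrite !horner_coef (big_morph (fun a : K => a ^+ q) frobD frob0).
move=> e; rewrite -[RHS]e; apply: eq_bigr => i _.
by rewrite coef_map /= exprMn frob_iota -!exprM mulnC.
Qed.

(** The iterates of Frobenius permute the finitely many roots of an equation of x
    over F, so two of them agree at x, and Frobenius is injective. *)
Lemma alg_periodic (x : K) : integralOver iota x ->
  exists2 k, (0 < k)%N & x ^+ (q ^ k) = x.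
Proof.
case=> m m_monic mx; set M := map_poly iota m in mx.
have M0 : M != 0 by rewrite map_poly_eq0 monic_neq0.
pose g (i : 'I_(size M)) := x ^+ (q ^ i).
have hroots : all (root M) (codom g).
  by apply/allP => _ /codomP[i ->]; apply: root_frob.
have [ginj|] := boolP (injectiveb g).
  by have := max_poly_roots M0 hroots ginj; rewrite size_codom card_ord ltnn.
move=> /injectivePn[i [j ij gij]].
wlog lij : i j ij gij / (i < j)%N => [W|].
  have [l|l|/val_inj e] := ltngtP i j; [exact: (W i j)|by apply: (W j i) => //; rewrite eq_sym|].
  by rewrite e eqxx in ij.
exists (j - i)%N; first by rewrite subn_gt0.
by apply: (@frob_iter_inj i); rewrite /= -exprM -expnD subnK 1?ltnW //.
Qed.

Lemma seq_periodic (s : seq K) : integralRange iota ->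
  exists2 k, (0 < k)%N & forall x, x \in s -> x ^+ (q ^ k) = x.
Proof.
move=> halg; elim: s => [|x s [k k0 ih]]; first by exists 1%N.
have [l l0 hl] := alg_periodic (halg x).
have it (y : K) m n : y ^+ (q ^ m) = y -> y ^+ (q ^ (m * n)) = y.
  by move=> hy; elim: n => [|n ihn]; rewrite ?muln0 // mulnS expnD exprM hy.
exists (k * l)%N; first by rewrite muln_gt0 k0.
move=> y; rewrite inE => /orP[/eqP ->|/ih hy]; last exact: it.
by rewrite mulnC it.
Qed.

End Frobenius.

(** * Elimination in one variable over a domain *)

Section Elimination.
Variable R : idomainType.

(** If f and g are coprime over the fraction field, Bezout gives c. Otherwise a
    multiple of f by a constant is the product of gcd(f, g) and a cofactor, one of
    which lies in the prime ideal J, so f can be replaced by it. The degree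
    fails to drop only if f divides g up to a constant, and then this constant
    lies in J because g does not. *)
Lemma prime_ideal_elimination (J : {poly R} -> Prop) (f g : {poly R}) :
    (forall r s, J s -> J (r * s)) -> (forall r s, J (r * s) -> J r \/ J s) ->
    J f -> f != 0 -> ~ J g ->
  exists2 c : R, c != 0 &
    J c%:P \/ exists p u v, J p /\ u * p + v * g = c%:P.
Proof.
move=> Jmul Jprime; have [n] := ubnP (size f); elim: n f => // n IHn f le_f Jf f0 nJg.
have [cop|ncop] := boolP (coprimep f g).
  have /Bezout_coprimepP[[u v] /= /eqpP[[c1 c2] /= /andP[c1_0 c2_0] e]] := cop.
  exists c2 => //; right; exists f, (c1%:P * u), (c1%:P * v); split=> //.
  by rewrite -!mulrA -mulrDr mul_polyC e alg_polyC.
pose d := gcdp f g.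
have d_gt1 : (1 < size d)%N.
  by rewrite ltn_neqAle eq_sym ncop size_poly_gt0 gcdp_eq0 negb_and f0.
have d0 : d != 0 by rewrite -size_poly_gt0 ltnW.
have dgE := Pdiv.Idomain.dvdp_eq d.
have [df dg] : d %| f /\ d %| g by rewrite dvdp_gcdl dvdp_gcdr.
have lc0 p : p != 0 -> forall k, lead_coef p ^+ k != 0 :> R.
  by move=> p0 k; rewrite expf_neq0 // lead_coef_eq0.
move: (df); rewrite dgE -mul_polyC => /eqP ef.
have szdf : (size d <= size f)%N by apply: dvdp_leq.
have /Jprime[Jh|Jd] : J ((f %/ d) * d) by rewrite -ef; apply: Jmul.
  apply: (IHn _ _ Jh) => //.
    rewrite -ltnS (leq_trans _ le_f) // ltnS size_divp // ltn_subrL.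
    by rewrite -(subnKC d_gt1) /= (leq_trans _ szdf) // -(subnKC d_gt1).
  apply/negP => /eqP h0; move/eqP: ef.
  by rewrite h0 mul0r mulf_eq0 polyC_eq0 (negPf f0) (negPf (lc0 _ d0 _)).
have [lt|] := ltnP (size d) (size f).
  by apply: (IHn d) => //; apply: leq_trans lt _.
move=> ge; have fd : f %| d.
  by have := dvdp_size_eqp df; rewrite eqn_leq szdf ge => /esym/andP[].
have := dvdp_trans fd dg; rewrite Pdiv.Idomain.dvdp_eq -mul_polyC => /eqP eg.
exists (lead_coef f ^+ scalp g f); first exact: lc0.
have : J ((lead_coef f ^+ scalp g f)%:P * g) by rewrite eg; apply: Jmul.
by case/Jprime => // h; left.
Qed.

(** A nonconstant divisor of least degree is irreducible over the fraction field,
    which is what the dichotomy expresses without leaving R. *)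
Lemma prime_factor (f : {poly R}) : (1 < size f)%N ->
  exists p : {poly R}, [/\ (1 < size p)%N, p %| f &
    forall r, p %| r \/ coprimep p r].
Proof.
have [n] := ubnP (size f); elim: n f => // n IHn f le_f f_gt1.
have [h|/asboolP] := pselect (forall r, f %| r \/ coprimep f r).
  by exists f; rewrite dvdpp.
rewrite asbool_neg => /existsp_asboolPn[r /not_orP[fr cop]].
have f0 : f != 0 by rewrite -size_poly_gt0 ltnW.
pose d := gcdp f r.
have d_gt1 : (1 < size d)%N.
  rewrite ltn_neqAle eq_sym size_poly_gt0 gcdp_eq0 negb_and f0 andbT.
  exact/negP.
have lt : (size d < size f)%N.
  rewrite ltnNge; apply/negP => ge; apply: fr.
  have := dvdp_size_eqp (dvdp_gcdl f r).
  rewrite eqn_leq dvdp_leq ?dvdp_gcdl //= ge => /esym/andP[_ fd].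
  exact: dvdp_trans fd (dvdp_gcdr f r).
have [p [p1 pd hp]] := IHn d (leq_trans lt le_f) d_gt1.
by exists p; split=> //; apply: dvdp_trans pd (dvdp_gcdl f r).
Qed.

End Elimination.

(** * Irreducible closed sets and their affine ideals *)

Section Topology.
Local Open Scope classical_set_scope.
Variables (F : finFieldType) (K : fieldType) (iota : {rmorphism F -> K}).
Local Notation ev := (evalK iota).
Implicit Types (P Q : {mpoly F[4]}) (v : 'I_4 -> K) (Z W : set ('I_4 -> K)).

Definition vanishes_on P Z := forall v, Z v -> ev P v = 0.

Lemma closed_zero_locus d e P : bihomogeneous d e P ->
  zariski_closed iota (zero_locus iota P).
Proof.
move=> hP; exists [set P]; split; first by move=> _ ->; exists d, e.
by apply/seteqP; split=> v [hv h]; split=> //; [move=> _ ->|exact: h].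
Qed.

Lemma closed_P1xP1 Z v : zariski_closed iota Z -> Z v -> P1xP1 v.
Proof. by case=> S [_ ->] []. Qed.

Lemma closed_separate Z W : zariski_closed iota Z -> W `<=` @P1xP1 K ->
  ~ W `<=` Z -> exists d e P,
    [/\ bihomogeneous d e P, vanishes_on P Z & exists2 w, W w & ev P w != 0].
Proof.
case=> S [hS ->] W1 WZ; apply: contrapT => hn; apply: WZ => w Ww.
split=> [|P SP]; first exact: W1.
have [d [e hP]] := hS P SP.
apply/eqP/negP => /negP nz; apply: hn; exists d, e, P; split=> //; last by exists w.
by move=> v [_]; apply.
Qed.

Lemma irreducible_vanishes_mul Z d e P d' e' Q : irreducible_closed iota Z ->
    bihomogeneous d e P -> bihomogeneous d' e' Q -> vanishes_on (P * Q) Z ->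
  vanishes_on P Z \/ vanishes_on Q Z.
Proof.
move=> [cZ _ irrZ] hP hQ hPQ.
have [|h|h] := irrZ _ _ (closed_zero_locus hP) (closed_zero_locus hQ).
- move=> v Zv; have := hPQ v Zv; rewrite evM => /eqP.
  by rewrite mulf_eq0 => /orP[]/eqP h; [left|right]; split=> //; apply: closed_P1xP1 Zv.
- by left=> v /h[].
- by right=> v /h[].
Qed.

Arguments irreducible_vanishes_mul {Z d e P d' e' Q}.

(** The ideal of the part of Z in the chart; it is all of F[x][y] when Z lies on
    the boundary. *)
Definition affine_ideal Z (p : {poly {poly F}}) := forall v, Z v ->
  v iX1 != 0 -> v iY1 != 0 -> ev2 iota (v iX0 / v iX1) (v iY0 / v iY1) p = 0.

Lemma affine_idealM Z r p : affine_ideal Z p -> affine_ideal Z (r * p).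
Proof. by move=> h v Zv h1 h3; rewrite rmorphM /= (h v) // mulr0. Qed.

Lemma affine_ideal_prime Z r p : irreducible_closed iota Z ->
  affine_ideal Z (r * p) -> affine_ideal Z r \/ affine_ideal Z p.
Proof.
move=> irrZ hrp.
have [N [P [N0 hP eP]]] := homogenize iota r.
have [M [Q [M0 hQ eQ]]] := homogenize iota p.
have aff n f w : (0 < n)%N -> (forall v, ev f v =
   (v iX1 * v iY1) ^+ n * ev2 iota (v iX0 / v iX1) (v iY0 / v iY1) w) ->
   vanishes_on f Z -> affine_ideal Z w.
  move=> n0 ef fZ v Zv h1 h3; apply/eqP.
  by have /eqP := fZ v Zv; rewrite ef mulf_eq0 expf_eq0 n0 mulf_eq0 (negPf h1) (negPf h3).
have [|h|h] := irreducible_vanishes_mul irrZ hP hQ.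
- move=> v Zv; rewrite evM eP eQ.
  have [->|h1] := eqVneq (v iX1) 0.
    by rewrite mul0r expr0n gtn_eqF // !mul0r.
  have [->|h3] := eqVneq (v iY1) 0.
    by rewrite mulr0 expr0n gtn_eqF // !mul0r.
  by rewrite mulrACA -rmorphM /= hrp // mulr0.
- by left; apply: aff eP h.
- by right; apply: aff eQ h.
Qed.

Lemma affine_ideal_dehom Z d e P : bihomogeneous d e P ->
  vanishes_on P Z -> affine_ideal Z (dehom P).
Proof.
move=> hP hZ v Zv h1 h3; apply/eqP; have /eqP := hZ v Zv.
by rewrite (ev_dehom _ hP) // !mulf_eq0 !expf_eq0 (negPf h1) (negPf h3) !andbF.
Qed.

(** The product P X1 Y1 vanishes on all of Z as soon as P does so on the chart. *)
Lemma affine_ideal_boundary Z d e P : irreducible_closed iota Z ->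
    bihomogeneous d e P -> affine_ideal Z (dehom P) ->
  [\/ vanishes_on P Z, vanishes_on 'X_iX1 Z | vanishes_on 'X_iY1 Z].
Proof.
move=> irrZ hP hZ; have hX := @bihom_varX F iX1 isT; have hY := @bihom_varY F iY1 isT.
have [|h|h] := irreducible_vanishes_mul irrZ hP (bihomM hX hY).
- move=> v Zv; rewrite !evM !ev_var.
  have [->|h1] := eqVneq (v iX1) 0; first by rewrite mul0r mulr0.
  have [->|h3] := eqVneq (v iY1) 0; first by rewrite !mulr0.
  by rewrite (ev_dehom _ hP) // hZ // mulr0 mul0r.
- by constructor 1.
- by have [h'|h'] := irreducible_vanishes_mul irrZ hX hY h;
    [constructor 2|constructor 3].
Qed.

Variables (q : nat) (hF : #|F| = q).

(** For N = q^k this says that the points of Z are defined over the field with N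
    elements; the point at infinity of P^1 satisfies the equation because
    s / 0 = 0. *)
Definition coords_fixed N Z := forall v, Z v ->
  (v iX0 / v iX1) ^+ N = v iX0 / v iX1 /\ (v iY0 / v iY1) ^+ N = v iY0 / v iY1.

Lemma coords_normal N v : (0 < N)%N -> P1xP1 v ->
    (v iX0 / v iX1) ^+ N = v iX0 / v iX1 ->
    (v iY0 / v iY1) ^+ N = v iY0 / v iY1 ->
  exists a b (w : 'I_4 -> K), v = rescale a b w /\ forall i, w i ^+ N = w i.
Proof.
move=> N0 /andP[vX vY] eX eY.
have norm (s t : K) : (s != 0) || (t != 0) -> (s / t) ^+ N = s / t ->
    exists a s' t', [/\ s = a * s', t = a * t', s' ^+ N = s' & t' ^+ N = t'].
  have [->|t0] := eqVneq t 0 => h hst.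
    by exists s, 1, 0; rewrite mulr1 mulr0 expr1n expr0n gtn_eqF.
  by exists t, (s / t), 1; rewrite mulrC mulfVK // mulr1 expr1n.
have [a [s0 [s1 [e0 e1 f0 f1]]]] := norm _ _ vX eX.
have [b [t0 [t1 [g0 g1 h0 h1]]]] := norm _ _ vY eY.
exists a, b, (fun i => nth 0 [:: s0; s1; t0; t1] i); split.
  by apply/funext => i; case/or4P: (ord4E i) => /eqP ->.
by move=> i; case/or4P: (ord4E i) => /eqP ->.
Qed.

(** Let P vanish on Z0 but not on Z1, and let T be a monomial of the same bidegree
    that is nonzero at a point z of Z0. With N + 1 = q^k, the values of P and T on
    Z1 are, up to a common factor, elements c and t with c^(N+1) = c and
    t^(N+1) = t, so P T (P^N - T^N) vanishes on Z1. By irreducibility one of the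
    three factors does: not P by its choice, not T because of z, and not P^N - T^N
    either, because at z it equals - T^N. *)
Lemma coords_fixed_minimal k Z0 Z1 : (0 < k)%N -> irreducible_closed iota Z1 ->
  zariski_closed iota Z0 -> Z0 !=set0 -> Z0 `<` Z1 -> coords_fixed (q ^ k) Z1 -> False.
Proof.
move=> k0 irr1 cl0 [z Z0z] [Z01 Z10] fix1; have [cl1 _ _] := irr1.
have [|d [e [P [hP P0 [w Z1w Pw]]]]] := closed_separate cl0 _ Z10.
  by move=> v; apply: closed_P1xP1.
have [i [j [zi zj hi hj]]] : exists i j : 'I_4, [/\ z i != 0, z j != 0,
    bihomogeneous 1 0 ('X_i : {mpoly F[4]}) & bihomogeneous 0 1 ('X_j : {mpoly F[4]})].
  case/andP: (closed_P1xP1 cl0 Z0z) => /orP[] zx /orP[] zy.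
  - by exists iX0, iY0; split=> //; [apply: bihom_varX|apply: bihom_varY].
  - by exists iX0, iY1; split=> //; [apply: bihom_varX|apply: bihom_varY].
  - by exists iX1, iY0; split=> //; [apply: bihom_varX|apply: bihom_varY].
  - by exists iX1, iY1; split=> //; [apply: bihom_varX|apply: bihom_varY].
pose T : {mpoly F[4]} := 'X_i ^+ d * 'X_j ^+ e.
have hT : bihomogeneous d e T.
  by have := bihomM (bihomX d hi) (bihomX e hj); rewrite !mul1n !mul0n addn0.
have Tz : ev T z != 0 by rewrite evM !evX !ev_var mulf_neq0 ?expf_neq0.
clearbody T.
have [N eN N0] : exists2 N, (q ^ k = N.+1)%N & (0 < N)%N.
  exists (q ^ k).-1; first by rewrite prednK // expn_gt0 (q_gt0 hF).
  by rewrite -ltnS prednK ?expn_gt0 ?(q_gt0 hF) // -(exp1n k) ltn_exp2r ?(q_gt1 hF).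
have hPN := bihomX N hP; have hTN := bihomX N hT.
have [|h|h] := irreducible_vanishes_mul irr1 (bihomM hP hT) (bihomD hPN (bihomN hTN)).
- move=> v Z1v; have [ex ey] := fix1 v Z1v.
  have [|a [b [u [-> hu]]]] := coords_normal _ (closed_P1xP1 cl1 Z1v) ex ey.
    by rewrite expn_gt0 (q_gt0 hF).
  rewrite !evM evD evN !evX (ev_rescale iota a b u hP) (ev_rescale iota a b u hT).
  set s := a ^+ d * b ^+ e.
  have evu R : ev R u ^+ N.+1 = ev R u.
    by rewrite -eN (ev_frob_iter hF); congr evalK; apply/funext.
  have /= := (evu P, evu T); move: (ev P u) (ev T u) => p t [] ep et.
  have -> : s * p * (s * t) * ((s * p) ^+ N - (s * t) ^+ N) =
    s * s * s ^+ N * (p * p ^+ N * t - p * (t * t ^+ N)) by rewrite !exprMn; ring.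
  by rewrite -!exprS ep et subrr mulr0.
- case: (irreducible_vanishes_mul irr1 hP hT h) => [h1|h1].
    by rewrite (h1 w Z1w) eqxx in Pw.
  by rewrite (h1 z (Z01 z Z0z)) eqxx in Tz.
- move: Tz; have /eqP := h z (Z01 z Z0z).
  by rewrite evD evN !evX (P0 z Z0z) expr0n gtn_eqF // add0r oppr_eq0 expf_eq0 N0 /= => ->.
Qed.

End Topology.

(** * The special form and smoothness of its curve *)

(** Locked, as is special_form, so that comparing two forms does not unfold them
    down to the coefficients of polynomials. *)
HB.lock Definition fermat_form (F : finFieldType) (q k : nat) (i j : 'I_k) :
  {mpoly F[k]} := 'X_i ^+ q * 'X_j - 'X_i * 'X_j ^+ q.

HB.lock Definition special_form (F : finFieldType) (q : nat) (n : F) (k : nat)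
    (i j : 'I_k) : {mpoly F[k]} :=
  'X_i ^+ q.+1 - n *: 'X_j ^+ q.+1 + fermat_form F q i j.

Section SpecialForm.
Variables (F : finFieldType) (q : nat) (hF : #|F| = q) (n : F).
Hypothesis nsq : forall a : F, a ^+ 2 != n.

Local Notation fermat_form := (fermat_form F q).
Local Notation special_form := (special_form q n).
Local Notation f := (special_form (@Ordinal 2 0 isT) (@Ordinal 2 1 isT)).

Lemma special_form_homog : f \is q.+1.-homog.
Proof.
have h i : ('X_i : {mpoly F[2]}) \is 1.-homog by rewrite dhomogX /= mdeg1.
have hX i k : ('X_i ^+ k : {mpoly F[2]}) \is k.-homog.
  by have := dhomogMn k (h i); rewrite mul1n.
rewrite special_form.unlock fermat_form.unlock.
apply: dhomogD; first by apply: dhomogD => //; rewrite dhomogN; apply: dhomogZ.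
apply: dhomogD; first by rewrite -[q.+1]addn1; apply: dhomogM.
by rewrite dhomogN -[q.+1]add1n; apply: dhomogM.
Qed.

Lemma curve_polyE : curve_poly q f f =
  special_form iY0 iY1 * fermat_form iX0 iX1 +
  special_form iX0 iX1 * fermat_form iY0 iY1.
Proof.
have comp (i j : 'I_4) : f \mPo [tuple 'X_i; 'X_j] = special_form i j.
  rewrite special_form.unlock fermat_form.unlock !(rmorphD, rmorphN, rmorphM, rmorphXn) /=.
  by rewrite comp_mpolyZ !rmorphXn /= !comp_mpolyXU.
by rewrite /curve_poly !comp fermat_form.unlock.
Qed.

Section Values.
Variables (K : fieldType) (iota : {rmorphism F -> K}).
Local Notation ev := (evalK iota).

Definition fermat_val (a b : K) := a ^+ q * b - a * b ^+ q.
Definition special_val (a b : K) :=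
  a ^+ q.+1 - iota n * b ^+ q.+1 + fermat_val a b.

Lemma ev_fermat i j v : ev (fermat_form i j) v = fermat_val (v i) (v j).
Proof. by rewrite fermat_form.unlock evD evN !evM !evX !ev_var. Qed.

Lemma ev_special i j v : ev (special_form i j) v = special_val (v i) (v j).
Proof. by rewrite special_form.unlock evD ev_fermat evD evN evZ !evX !ev_var. Qed.

Lemma ev_curve v : ev (curve_poly q f f) v =
  special_val (v iY0) (v iY1) * fermat_val (v iX0) (v iX1) +
  special_val (v iX0) (v iX1) * fermat_val (v iY0) (v iY1).
Proof. by rewrite curve_polyE evD !evM !ev_fermat !ev_special. Qed.

Lemma mderiv_frob (i : 'I_4) (P : {mpoly F[4]}) : (P ^+ q)^`M(i) = 0.
Proof.
have dX k : (P ^+ k)^`M(i) = (P ^+ k.-1 * P^`M(i)) *+ k.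
  elim: k => [|k IHk]; first by rewrite expr0 -mpolyC1 mderivC.
  rewrite exprS mderivM IHk mulrnAr mulrA [in RHS]mulrSr addrC [P^`M(i) * _]mulrC.
  by case: k {IHk} => [|k]; rewrite ?mulr0n //= -exprS.
rewrite dX -mulr_natr; have -> : q%:R = 0 :> {mpoly F[4]}; last by rewrite mulr0.
exact: (q_eq0 hF (@mpolyC 4 F)).
Qed.

Lemma mderiv_var (i j : 'I_4) : ('X_j)^`M(i) = (j == i)%:R :> {mpoly F[4]}.
Proof.
rewrite mderivX mnm1E; case: eqP => [->|_]; last by rewrite scale0r.
by rewrite scale1r -{1}[U_(i)%MM]add0m addmK mpolyX0.
Qed.

Lemma ev_dfermat k i j v : ev ((fermat_form i j)^`M(k)) v =
  (j == k)%:R * v i ^+ q - (i == k)%:R * v j ^+ q.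
Proof.
rewrite fermat_form.unlock mderivB !mderivM !mderiv_frob mul0r mulr0 add0r addr0 !mderiv_var.
rewrite evD evN !evM !evX !ev_var mulrC.
by congr (_ * _ - _ * _); rewrite -mpolyC_nat evC rmorph_nat.
Qed.

Lemma ev_dspecial k i j v : ev ((special_form i j)^`M(k)) v =
  (i == k)%:R * (v i ^+ q - v j ^+ q) +
  (j == k)%:R * (v i ^+ q - iota n * v j ^+ q).
Proof.
rewrite special_form.unlock mderivD mderivB mderivZ !exprSr !mderivM !mderiv_frob !mul0r !add0r.
rewrite !mderiv_var evD ev_dfermat evD evN evZ !evM !evX !ev_var.
by rewrite -!mpolyC_nat !evC !rmorph_nat; ring.
Qed.

Lemma ev_dcurve k v : ev ((curve_poly q f f)^`M(k)) v =
  ((iY0 == k)%:R * (v iY0 ^+ q - v iY1 ^+ q) +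
   (iY1 == k)%:R * (v iY0 ^+ q - iota n * v iY1 ^+ q)) *
    fermat_val (v iX0) (v iX1) +
  special_val (v iY0) (v iY1) *
    ((iX1 == k)%:R * v iX0 ^+ q - (iX0 == k)%:R * v iX1 ^+ q) +
  (((iX0 == k)%:R * (v iX0 ^+ q - v iX1 ^+ q) +
    (iX1 == k)%:R * (v iX0 ^+ q - iota n * v iX1 ^+ q)) *
    fermat_val (v iY0) (v iY1) +
   special_val (v iX0) (v iX1) *
    ((iY1 == k)%:R * v iY0 ^+ q - (iY0 == k)%:R * v iY1 ^+ q)).
Proof.
rewrite curve_polyE mderivD !mderivM !evD !evM.
rewrite (ev_fermat iX0) (ev_fermat iY0) (ev_special iX0) (ev_special iY0).
rewrite (ev_dspecial k iX0 iX1) (ev_dspecial k iY0 iY1).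
by rewrite (ev_dfermat k iX0 iX1) (ev_dfermat k iY0 iY1).
Qed.

Lemma fermat_val_eq0 a b : fermat_val a b = 0 -> (a / b) ^+ q = a / b.
Proof.
move=> h; have [->|b0] := eqVneq b 0; first by rewrite invr0 mulr0 (frob0 hF).
rewrite expr_div_n; apply/eqP; rewrite eqr_div ?expf_neq0 //.
by rewrite -subr_eq0 -/(fermat_val a b) h.
Qed.

(** The fixed points of Frobenius are the elements of F, where n has no root. *)
Lemma nonsquare_fixed (x : K) : x ^+ q = x -> x ^+ 2 != iota n.
Proof.
case/(frob_fixed hF iota) => c ->; rewrite -rmorphXn /=.
by apply: contra (nsq c) => /eqP/fmorph_inj ->.
Qed.

(** At a rational point a / b with b nonzero, the form takes the value
    b^(q+1) ((a / b)^2 - n). *)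
Lemma special_val_neq0 a b : (a != 0) || (b != 0) -> fermat_val a b = 0 ->
  special_val a b != 0.
Proof.
move=> ab hA; rewrite /special_val hA addr0; have [b0|b0] := eqVneq b 0.
  by move: ab; rewrite b0 eqxx orbF expr0n mulr0 subr0 => a0; rewrite expf_neq0.
have := nonsquare_fixed (fermat_val_eq0 hA); apply: contra; rewrite subr_eq0 => /eqP e.
rewrite expr2 -{1}(fermat_val_eq0 hA) -exprSr expr_div_n e mulfK //.
by rewrite expf_neq0.
Qed.

(** The hypotheses say that both partial derivatives in X vanish at (a : b), with
    s = A(Y) and t = f(Y). For x = a / b they read x^q = 1 + t / s and
    x^q (1 + t / s) = n, so that (x^2)^q = n = n^q and x^2 = n. Thus x^q is x or
    - x, and the first is excluded since n is not a square in F. *)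
Lemma critical_point a b s t : (a != 0) || (b != 0) -> s != 0 ->
    (a ^+ q - b ^+ q) * s - t * b ^+ q = 0 ->
    (a ^+ q - iota n * b ^+ q) * s + t * a ^+ q = 0 ->
  [/\ b != 0, (a / b) ^+ 2 = iota n, (a / b) ^+ q = - (a / b) &
      t = s * (- (a / b) - 1)].
Proof.
move=> ab s0 e1 e2; have b0 : b != 0.
  apply: contraTneq ab => b0; rewrite b0 eqxx orbF negbK.
  move/eqP: e1; rewrite b0 (frob0 hF) subr0 mulr0 subr0 mulf_eq0 (negPf s0) orbF.
  by rewrite expf_eq0 => /andP[].
have bq0 : b ^+ q != 0 by rewrite expf_neq0.
pose x := a / b; have aE : a = x * b by rewrite /x divfK.
rewrite -/x; clearbody x; have {}e1 : (x ^+ q - 1) * s = t.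
  apply: (mulIf bq0); apply/eqP; rewrite -subr_eq0 -e1 aE exprMn; apply/eqP; ring.
have {}e2 : x ^+ q * (s + t) = iota n * s.
  apply: (mulIf bq0); apply/eqP; rewrite -subr_eq0 -e2 aE exprMn; apply/eqP; ring.
have x2 : x ^+ 2 = iota n.
  apply: (frob_inj hF iota); rewrite /= (frob_iota hF) -exprM mulnC exprM.
  by apply: (mulIf s0); rewrite -e2 -e1; ring.
have xq : x ^+ q = - x.
  have : (x ^+ q - x) * (x ^+ q + x) = 0.
    by rewrite -subr_sqr -exprM mulnC exprM x2 (frob_iota hF) subrr.
  move/eqP; rewrite mulf_eq0 subr_eq0 addr_eq0 => /orP[]/eqP // xq.
  by have := nonsquare_fixed xq; rewrite x2 eqxx.
by split=> //; rewrite -e1 xq mulrC.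
Qed.

(** That is, h = f / A takes the value x + 1 at its critical point x. *)
Lemma special_val_critical a b : b != 0 -> (a / b) ^+ 2 = iota n ->
    (a / b) ^+ q = - (a / b) ->
  special_val a b = fermat_val a b * (a / b + 1).
Proof.
move=> b0; have aE : a = a / b * b by rewrite divfK.
move: (a / b) aE => x aE x2 xq.
rewrite /special_val /fermat_val aE !exprSr !exprMn xq -x2; ring.
Qed.

Lemma curve_smooth : odd q -> smooth_curve iota (curve_poly q f f).
Proof.
move=> q_odd [v [[/andP[vX vY] _] hv]].
have {}hv k := etrans (esym (ev_dcurve k v)) (hv k).
have := (hv iX0, hv iX1, hv iY0, hv iY1).
rewrite /=.
rewrite !(mul0r, mul1r, mulr0, mulr1, add0r, addr0, subr0, sub0r, oppr0).
move: (v iX0) (v iX1) (v iY0) (v iY1) vX vY => a b c d ab cd.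
case=> [[[e1 e2] e3] e4].
(* If Y were rational, the derivatives in X would force f(Y) = 0. *)
have neq0 a' b' c' d' : (a' != 0) || (b' != 0) -> (c' != 0) || (d' != 0) ->
    special_val c' d' * - b' ^+ q + (a' ^+ q - b' ^+ q) * fermat_val c' d' = 0 ->
    special_val c' d' * a' ^+ q + (a' ^+ q - iota n * b' ^+ q) * fermat_val c' d' = 0 ->
  fermat_val c' d' != 0.
  move=> ab' cd' h1 h2; apply/eqP => s0; have := special_val_neq0 cd' s0.
  move: h1 h2; rewrite s0 !mulr0 !addr0 mulrN => /eqP h1 /eqP h2.
  move: h1 h2; rewrite oppr_eq0 !mulf_eq0 !expf_eq0 (q_gt0 hF) /=.
  by case: eqP => //= _ hb ha; rewrite (eqP ha) (eqP hb) eqxx in ab'.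
have s0 : fermat_val c d != 0 by apply: (neq0 a b).
have t0 : fermat_val a b != 0 by apply: (neq0 c d) => //; rewrite addrC.
have [||b0 x2 xq ex] := critical_point ab s0 (t := special_val c d).
- by rewrite -e1; ring.
- by rewrite -e2; ring.
have [||d0 y2 yq _] := critical_point cd t0 (t := special_val a b).
- by rewrite -e3; ring.
- by rewrite -e4; ring.
move: ex; rewrite special_val_critical // => /(mulfI s0) exy.
move: (a / b) (c / d) x2 y2 exy => x y x2 y2 exy.
(* 0 = x^2 - y^2 = (- y - 2)^2 - y^2 = 4 (y + 1) *)
have p1 : y + 1 = 0.
  have : (y + 1) *+ 4 = 0.
    have xE : x = - y - 2 by rewrite -[y](addrK 1) exy; ring.
    transitivity (x ^+ 2 - y ^+ 2); last by rewrite x2 y2 subrr.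
    by rewrite xE; ring.
  rewrite -mulr_natr => /eqP; rewrite mulf_eq0 => /orP[/eqP //|].
  rewrite (natrM _ 2 2) mulf_eq0 orbb => two0.
  have q2 : q%:R = 0 :> K := q_eq0 hF iota.
  move: q2; rewrite -(odd_double_half q) q_odd natrD -muln2 natrM (eqP two0) mulr0 addr0.
  by move/eqP; rewrite oner_eq0.
have := nsq 1; rewrite expr1n -(inj_eq (fmorph_inj iota)) rmorph1 -y2.
by rewrite (_ : y = -1) ?sqrrN ?expr1n ?eqxx //; apply/eqP; rewrite -addr_eq0 p1.
Qed.
End Values.
End SpecialForm.

(** * Chains of irreducible closed subsets of a curve *)

Section ClosedField.
Variables (F : finFieldType) (K : closedFieldType) (iota : {rmorphism F -> K}).

(** A root of X g(X) + 1 is not a root of g. *)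
Lemma exists_non_root (g : {poly K}) : g != 0 -> exists x, g.[x] != 0.
Proof.
move=> g0; have [|x /rootP hx] := closed_rootP (g * 'X + 1) _.
  by rewrite -polyC1 size_MXaddC (negPf g0) /= eqSS size_poly_eq0.
exists x; apply/eqP => gx; move/eqP: hx.
by rewrite !hornerE gx mul0r add0r oner_eq0.
Qed.

Lemma exists_ev1_neq0 (c : {poly F}) : c != 0 -> exists x : K, ev1 iota x c != 0.
Proof. by move=> c0; apply: exists_non_root; rewrite map_poly_eq0. Qed.

(** Where the leading coefficient of p in y does not vanish, the specialization of
    p keeps its positive degree. *)
Lemma exists_plane_zero (p : {poly {poly F}}) (c : {poly F}) :
  (1 < size p)%N -> c != 0 -> exists x y : K,
    [/\ ev1 iota x c != 0, ev1 iota x (lead_coef p) != 0 & ev2 iota x y p = 0].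
Proof.
move=> p1 c0; have l0 : lead_coef p != 0 by rewrite lead_coef_eq0 -size_poly_gt0 ltnW.
have [x] := exists_ev1_neq0 (mulf_neq0 c0 l0).
rewrite rmorphM mulf_eq0 negb_or => /andP[xc xl].
have [|y /rootP hy] := closed_rootP (map_poly (ev1 iota x) p) _.
  by rewrite size_map_poly_id0 // gtn_eqF.
by exists x, y.
Qed.

End ClosedField.

Section CurveDimension.
Local Open Scope classical_set_scope.
Variables (F : finFieldType) (K : closedFieldType) (iota : {rmorphism F -> K}).
Local Notation ev := (evalK iota).

Definition affine_point (x y : K) : 'I_4 -> K := fun i => nth 0 [:: x; 1; y; 1] i.

Lemma P1xP1_affine x y : P1xP1 (affine_point x y).
Proof. by rewrite /P1xP1 /= oner_neq0 !orbT. Qed.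

Lemma ev_affine P x y : ev P (affine_point x y) = ev2 iota x y (dehom P).
Proof. by rewrite (@ev2_dehom _ _ _ P (affine_point x y)). Qed.

(** The smallest closed set containing the point z, which is the set of its
    conjugates, is irreducible: a closed set that contains z contains all of it. *)
Lemma conjugates_irreducible (z : 'I_4 -> K) : P1xP1 z ->
  irreducible_closed iota [set v | P1xP1 v /\ forall P,
    (exists d e, bihomogeneous d e P) /\ ev P z = 0 -> ev P v = 0].
Proof.
move=> z1; split; last 1 first.
- move=> A B [SA [hA ->]] [SB [hB ->]] sub.
  have [|[_ h]|[_ h]] := sub z; first by split=> // P [].
    by left=> v [v1 hv]; split=> // P SP; apply: hv; split; [apply: hA|apply: h].
  by right=> v [v1 hv]; split=> // P SP; apply: hv; split; [apply: hB|apply: h].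
- by eexists; split; last reflexivity; move=> P [].
- by exists z; split=> // P [].
Qed.

Hypothesis halg : integralRange iota.

(** With p an irreducible factor over F(x) of the affine equation of G, the set Z1
    below contains each zero (x, y) of p outside the zeros of the leading
    coefficient of p: pseudo-division by p introduces no other denominator. If A
    and B are closed and neither contains Z1, they have equations PA and PB that
    p does not divide, so p is coprime to PA PB; a Bezout relation then confines
    the points of Z1 in A or B to finitely many values of x, while Z1 has points
    with infinitely many. The latter also shows that Z1 is larger than the class
    of conjugates of one point, whose abscissas are roots of one polynomial. *)
Lemma has_chain1 d e (G : {mpoly F[4]}) : bihomogeneous d e G ->
  (1 < size (dehom G))%N -> has_chain iota (zero_locus iota G) 1.
Proof.
move=> hG /prime_factor[p [p1 pG pP]].
pose S P := (exists d e, bihomogeneous d e P) /\ p %| dehom P.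
pose Z1 : set ('I_4 -> K) := [set v | P1xP1 v /\ forall P, S P -> ev P v = 0].
have Z1G : Z1 `<=` zero_locus iota G.
  by move=> v [v1 hv]; split=> //; apply: hv; split=> //; exists d, e.
have pt x y : ev1 iota x (lead_coef p) != 0 -> ev2 iota x y p = 0 -> Z1 (affine_point x y).
  move=> xl xyp; split; first exact: P1xP1_affine.
  move=> P [_]; rewrite Pdiv.Idomain.dvdp_eq -mul_polyC => /eqP /(congr1 (ev2 iota x y)).
  rewrite !rmorphM /= xyp mulr0 ev_affine ev2C rmorphXn /= => /eqP.
  by rewrite mulf_eq0 expf_eq0 (negPf xl) andbF => /eqP.
have cl1 : zariski_closed iota Z1 by exists S; split=> // P [].
have [x0 [y0 [_ xl0 xyp0]]] := exists_plane_zero iota p1 (oner_neq0 _).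
have Z1z := pt _ _ xl0 xyp0; set z := affine_point x0 y0 in Z1z.
have irr1 : irreducible_closed iota Z1.
  split=> //; first by exists z.
  move=> A B cA cB sub; apply: contrapT => /not_orP[nA nB].
  have Z1P : Z1 `<=` @P1xP1 K by move=> v [].
  have nd Z : zariski_closed iota Z -> ~ Z1 `<=` Z -> exists P,
      vanishes_on iota P Z /\ coprimep p (dehom P).
    move=> cZ nZ; have [d' [e' [P [hP PZ [w [_ Z1w] Pw]]]]] := closed_separate cZ Z1P nZ.
    exists P; split=> //; case: (pP (dehom P)) => // pd.
    by move: Pw; rewrite Z1w ?eqxx //; split=> //; exists d', e'.
  have [PA [hA cop1]] := nd A cA nA; have [PB [hB cop2]] := nd B cB nB.
  have : coprimep p (dehom PA * dehom PB) by rewrite coprimepMr cop1.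
  case/Bezout_coprimepP => -[u w] /eqpP[[c1 c2] /= /andP[c10 c20] eq].
  have [x [y [xc xl xyp]]] := exists_plane_zero iota p1 c20.
  have [hz|hz] := sub _ (pt _ _ xl xyp).
  - move/(congr1 (ev2 iota x y)): eq; rewrite -!mul_polyC !(rmorphM, rmorphD) /= xyp.
    rewrite -[ev2 _ _ _ (dehom PA)]ev_affine hA // !(mul0r, mulr0, addr0) rmorph1 mulr1.
    by rewrite ev2C => e0; rewrite -e0 eqxx in xc.
  - move/(congr1 (ev2 iota x y)): eq; rewrite -!mul_polyC !(rmorphM, rmorphD) /= xyp.
    rewrite -[ev2 _ _ _ (dehom PB)]ev_affine hB // !(mul0r, mulr0, addr0) rmorph1 mulr1.
    by rewrite ev2C => e0; rewrite -e0 eqxx in xc.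
pose Z0 : set ('I_4 -> K) := [set v | P1xP1 v /\ forall P,
    (exists d e, bihomogeneous d e P) /\ ev P z = 0 -> ev P v = 0].
have irr0 : irreducible_closed iota Z0 by apply: conjugates_irreducible; case: Z1z.
have Z01 : Z0 `<=` Z1.
  move=> v [v1 hv]; split=> // P SP; apply: hv; split; first by case: SP.
  by case: Z1z => _; apply.
exists (fun i => if i == 0%N then Z0 else Z1); split.
  move=> [|i] _ /=; split=> //; exact: subset_trans Z01 Z1G.
move=> [|//] _ /=; split=> // Z10.
have [m m_monic mx] := halg x0.
have [N [P [_ hP eP]]] := homogenize iota m%:P.
have [x [y [xm xl xyp]]] := exists_plane_zero iota p1 (monic_neq0 m_monic).
have Paff x' y' : ev P (affine_point x' y') = ev1 iota x' m.
  by rewrite eP /= !mulr1 expr1n mul1r !invr1 !mulr1 ev2C.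
have [_ /(_ P) h] := Z10 _ (pt _ _ xl xyp).
have : ev P (affine_point x y) = 0.
  by apply: h; split; [exists N, N|rewrite /z Paff; apply/rootP].
by rewrite Paff => e0; rewrite e0 eqxx in xm.
Qed.

(** The hypothesis on fibres makes G(x, y) a nonzero polynomial in y for each x, so
    that finitely many abscissas allow finitely many points only; the one on the
    boundary says that the points outside the chart are rational. *)
Lemma chain_le1 q d e (G : {mpoly F[4]}) : #|F| = q -> bihomogeneous d e G ->
    dehom G != 0 ->
    (forall x : K, exists y, ev G (affine_point x y) != 0) ->
    (forall v, zero_locus iota G v -> v iX1 = 0 \/ v iY1 = 0 ->
      (v iX0 / v iX1) ^+ q = v iX0 / v iX1 /\ (v iY0 / v iY1) ^+ q = v iY0 / v iY1) ->
  forall m, has_chain iota (zero_locus iota G) m -> (m <= 1)%N.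
Proof.
move=> hF hG G0 fibre bdry m [Z [hZ hlt]]; rewrite leqNgt; apply/negP => m2.
have m1 := ltnW m2.
have [irr0 _] := hZ 0%N isT; have [irr1 sub1] := hZ 1%N m1; have [irr2 sub2] := hZ 2%N m2.
have lt01 := hlt 0%N m1; have lt12 := hlt 1%N m2.
move: (Z 0%N) (Z 1%N) (Z 2%N) irr0 irr1 irr2 sub1 sub2 lt01 lt12.
move=> {hZ hlt}Z0 Z1 Z2 irr0 irr1 irr2 sub1 sub2 lt01 lt12.
(* If x took finitely many values on Z1, all coordinates would be fixed by a
   common power of Frobenius, contradicting Z0 < Z1. *)
have no_fixed (c : {poly F}) : c != 0 -> affine_ideal iota Z1 c%:P -> False.
  move=> c0 hc.
  have c0' : map_poly iota c != 0 by rewrite map_poly_eq0.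
  have [xs xsE] := closed_field_poly_normal (map_poly iota c).
  pose fib x := map_poly (ev1 iota x) (dehom G).
  have fib0 x : fib x != 0.
    have [y] := fibre x; rewrite ev_affine; apply: contraNneq => e0.
    by rewrite /ev2 /= /horner_eval -/(fib x) e0 horner0.
  have rts (g : {poly K}) : exists rs : seq K, g != 0 -> forall x, root g x -> x \in rs.
    have [rs rsE] := closed_field_poly_normal g; exists rs => g0 x.
    by rewrite rsE rootZ ?lead_coef_eq0 // root_prod_XsubC.
  have [rs hrs] := choice rts.
  pose all_pts := rs (map_poly iota c) ++ flatten [seq rs (fib x) | x <- rs (map_poly iota c)].
  have [k k0 hk] := seq_periodic hF all_pts halg.
  have [cl0 ne0 _] := irr0.
  apply: (coords_fixed_minimal hF k0 irr1 cl0 ne0 lt01) => v Z1v.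
  have [/eqP v1|v1] := boolP (v iX1 == 0).
    by have [] := bdry v (sub1 v Z1v) (or_introl v1); split; apply: frob_iter_fixed.
  have [/eqP v3|v3] := boolP (v iY1 == 0).
    by have [] := bdry v (sub1 v Z1v) (or_intror v3); split; apply: frob_iter_fixed.
  have xin : v iX0 / v iX1 \in rs (map_poly iota c).
    by apply: hrs => //; apply/rootP; have := hc v Z1v v1 v3; rewrite ev2C.
  split; apply: hk; rewrite mem_cat ?xin //.
  apply/orP; right; apply/flatten_mapP; exists (v iX0 / v iX1) => //.
  apply: hrs => //; apply/rootP.
  have GZ1 : vanishes_on iota G Z1 by move=> u /sub1[].
  exact: (affine_ideal_dehom hG GZ1 Z1v v1 v3).
have G2 : affine_ideal iota Z2 (dehom G).
  by apply: (affine_ideal_dehom hG) => u /sub2[].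
have sub12 (p : {poly {poly F}}) : affine_ideal iota Z2 p -> affine_ideal iota Z1 p.
  by move=> hp v /(proj1 lt12); apply: hp.
have [cl1 _ _] := irr1; have [cl2 _ _] := irr2.
have Z2P : Z2 `<=` @P1xP1 K by move=> v; apply: closed_P1xP1 cl2.
have [d' [e' [Q [hQ Q1 [w Z2w Qw]]]]] := closed_separate cl1 Z2P (proj2 lt12).
have [Q2|nQ2] := pselect (affine_ideal iota Z2 (dehom Q)).
  apply: (no_fixed 1); first exact: oner_neq0.
  move=> v Z1v v1 v3; have Z2v := proj1 lt12 v Z1v.
  case: (affine_ideal_boundary irr2 hQ Q2) => h.
  - by rewrite h ?eqxx in Qw.
  - by have := h v Z2v; rewrite ev_var => e0; rewrite e0 eqxx in v1.
  - by have := h v Z2v; rewrite ev_var => e0; rewrite e0 eqxx in v3.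
have [||c c0 [Jc|[p [u [u' [Jp eq]]]]]] :=
  @prime_ideal_elimination _ (affine_ideal iota Z2) (dehom G) (dehom Q) _ _ G2 G0 nQ2.
- by move=> r s; apply: affine_idealM.
- by move=> r s; apply: affine_ideal_prime.
- exact: (no_fixed c c0 (sub12 _ Jc)).
apply: (no_fixed c c0); rewrite -eq => v Z1v v1 v3.
rewrite rmorphD !rmorphM /= (sub12 _ Jp v Z1v v1 v3).
by rewrite (affine_ideal_dehom hQ Q1 Z1v v1 v3) !mulr0 addr0.
Qed.

End CurveDimension.

(** * The special curve *)

(** Squaring is not injective in odd characteristic, so it is not surjective. *)
Lemma exists_nonsquare (F : finFieldType) : odd #|F| ->
  exists n : F, forall a : F, a ^+ 2 != n.
Proof.
move=> odF; pose sq (a : F) := a ^+ 2.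
suff /forallPn[n hn] : ~~ [forall n, n \in codom sq].
  exists n => a; apply: contra hn => /eqP <-; exact: codom_f.
apply/forallP => surj.
have /image_injP sq_inj : #|[seq sq a | a in F]| == #|F|.
  by apply/eqP/eq_card => n; rewrite [LHS]surj.
have two0 : 2%:R = 0 :> F.
  have /sq_inj-/(_ isT isT)/eqP : sq 1 = sq (-1) by rewrite /sq sqrrN.
  by rewrite -addr_eq0 -natr1 => /eqP.
have := q_eq0 (erefl #|F|) (idfun : {rmorphism F -> F}).
rewrite -(odd_double_half #|F|) odF natrD -muln2 natrM two0 mulr0 addr0.
by move/eqP; rewrite oner_eq0.
Qed.

Section SpecialCurve.
Local Open Scope classical_set_scope.
Variables (F : finFieldType) (q : nat) (hF : #|F| = q) (n : F).
Hypothesis nsq : forall a : F, a ^+ 2 != n.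
Variables (K : closedFieldType) (iota : {rmorphism F -> K}).
Hypothesis halg : integralRange iota.

Local Notation f := (special_form q n (@Ordinal 2 0 isT) (@Ordinal 2 1 isT)).
Local Notation G := (curve_poly q f f).
Local Notation fval := (@fermat_val q K).
Local Notation sval := (@special_val F q n K iota).

Lemma curve_bihomogeneous : bihomogeneous q.+1 q.+1 G.
Proof.
have hX (i j : 'I_4) d e : bihomogeneous d e ('X_i : {mpoly F[4]}) ->
    bihomogeneous d e ('X_j : {mpoly F[4]}) ->
    bihomogeneous (d * q.+1) (e * q.+1) (fermat_form F q i j) /\
    bihomogeneous (d * q.+1) (e * q.+1) (special_form q n i j).
  move=> hi hj; have hA : bihomogeneous (d * q.+1) (e * q.+1) (fermat_form F q i j).
    rewrite fermat_form.unlock; apply: bihomD.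
      by rewrite -[q.+1]addn1 !mulnDr !muln1; apply: bihomM => //; apply: bihomX.
    by apply: bihomN; rewrite !mulnS; apply: bihomM => //; apply: bihomX.
  split=> //; rewrite special_form.unlock; apply: bihomD => //; apply: bihomD.
    exact: bihomX.
  by apply/bihomN/bihomZ/bihomX.
have [hA0 hS0] := hX iX0 iX1 _ _ (bihom_varX iX0 isT) (bihom_varX iX1 isT).
have [hA1 hS1] := hX iY0 iY1 _ _ (bihom_varY iY0 isT) (bihom_varY iY1 isT).
rewrite curve_polyE; apply: bihomD.
  by have := bihomM hS1 hA0; rewrite !mul1n !mul0n add0n addn0.
by have := bihomM hS0 hA1; rewrite !mul1n !mul0n add0n addn0.
Qed.

Lemma ev_curve_affine x y : evalK iota G (affine_point x y) =
  sval y 1 * fval x 1 + sval x 1 * fval y 1.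
Proof. by rewrite ev_curve. Qed.

Lemma exists_not_fixed : exists x : K, fval x 1 != 0.
Proof.
have [|x] := @exists_non_root K ('X^q - 'X).
  rewrite -size_poly_eq0 size_polyDl ?size_polyXn // size_polyN size_polyX.
  by rewrite ltnS (q_gt1 hF).
by rewrite !hornerE => hx; exists x; rewrite /fermat_val expr1n !mulr1.
Qed.

(** A choice of y with A(y) nonzero works if A(x) = 0, and y = 0 works otherwise:
    f has no rational zero. *)
Lemma curve_fibre x : exists y, evalK iota G (affine_point x y) != 0.
Proof.
have [x0|x0] := eqVneq (fval x 1) 0.
  have [y hy] := exists_not_fixed; exists y.
  rewrite ev_curve_affine x0 mulr0 add0r mulf_neq0 //.
  by apply: (special_val_neq0 hF nsq) => //; rewrite oner_neq0 orbT.
exists 0; rewrite ev_curve_affine.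
have f0 : fval 0 1 = 0 by rewrite /fermat_val (frob0 hF) !mul0r subrr.
rewrite f0 mulr0 addr0 mulf_neq0 //.
by apply: (special_val_neq0 hF nsq) => //; rewrite oner_neq0 orbT.
Qed.

(** Otherwise the value at (x, y) would not depend on y, but the values at y = 0
    and y = 1 differ by A(x), as f(1, 1) - f(0, 1) = 1. *)
Lemma curve_dehom_size : (1 < size (dehom G))%N.
Proof.
rewrite ltnNge; apply/negP => /size1_polyC e.
have cst x y : evalK iota G (affine_point x y) = evalK iota G (affine_point x 0).
  by rewrite !ev_affine e !ev2C.
have [x hx] := exists_not_fixed; have := cst x 1.
have f0 : fval 0 1 = 0 by rewrite /fermat_val (frob0 hF) !mul0r subrr.
have f1 : fval 1 1 = 0 by rewrite /fermat_val expr1n subrr.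
rewrite !ev_curve_affine f0 f1 !mulr0 !addr0 => /(mulIf hx).
rewrite /special_val f0 f1 !expr1n expr0n !addr0 => /addIr/eqP.
by rewrite oner_eq0.
Qed.

(** If X1 = 0 then A(X) = 0 and f(X) is nonzero, so A(Y) = 0. *)
Lemma curve_boundary v : zero_locus iota G v -> v iX1 = 0 \/ v iY1 = 0 ->
  (v iX0 / v iX1) ^+ q = v iX0 / v iX1 /\ (v iY0 / v iY1) ^+ q = v iY0 / v iY1.
Proof.
case=> /andP[vX vY]; rewrite ev_curve.
have f0 a : fval a 0 = 0 by rewrite /fermat_val (frob0 hF) !mulr0 subrr.
have fix0 (a : K) : (a / 0) ^+ q = a / 0 by rewrite invr0 mulr0 (frob0 hF).
move=> h [e|e]; rewrite e in h vX vY *; split=> //; apply: (fermat_val_eq0 hF);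
    apply/eqP; move/eqP: h; rewrite f0 mulr0 ?add0r ?addr0 mulf_eq0 => /orP[|//].
  by rewrite (negPf (special_val_neq0 hF nsq iota vX (f0 _))).
by rewrite (negPf (special_val_neq0 hF nsq iota vY (f0 _))).
Qed.

Lemma curve_space_filling : space_filling_curve iota G.
Proof.
have sz := curve_dehom_size; have hG := curve_bihomogeneous.
split.
  split; first exact: (has_chain1 halg hG sz).
  apply: (chain_le1 halg hF hG _ curve_fibre curve_boundary).
  by rewrite -size_poly_gt0 ltnW.
apply/seteqP; split=> v; first by case.
split=> //; rewrite ev_curve.
by rewrite /fermat_val -hF !expf_card !subrr !mulr0 addr0.
Qed.

End SpecialCurve.

Theorem theorem1p2 (q : nat) (hq : odd q)
    (F : finFieldType) (hF : #|F| = q)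
    (Fbar : closedFieldType) (iota : {rmorphism F -> Fbar})
    (halg : integralRange iota) :
  exists f : {mpoly F[2]},
    [/\ f \is q.+1.-homog,
        smooth_curve iota (curve_poly q f f)
      & space_filling_curve iota (curve_poly q f f)].
Proof.
have [|n nsq] := @exists_nonsquare F; first by rewrite hF.
exists (special_form q n (@Ordinal 2 0 isT) (@Ordinal 2 1 isT)); split.
- exact: special_form_homog.
- exact: curve_smooth.
- exact: (curve_space_filling hF nsq halg).
Qed.
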